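(* Let $L\ge 1$ and $n\ge L+1$, let $w_1\ge\dots\ge w_n\ge 0$ be real weights, let $\mathrm{OPT}=\sum_{j=1}^L w_j$, and let $\beta\in[0,1]$ be defined by $w_L=\beta\cdot\mathrm{OPT}$. Run the $L$-Selection Secretary algorithm with exact additive gap (described in the context) with gap $c=w_L-w_{L+1}$ and waiting time $\tau=1/\mathrm{e}$. Then $$\mathbb{E}[\mathrm{ALG}]\ \ge\ \left(\frac{1}{\mathrm{e}}+\frac{\beta}{2\mathrm{e}}\left(1-\frac1L+\frac{1}{L\,\mathrm{e}^L}\right)\right)\cdot\mathrm{OPT}.$$
   Context: Multi-selection secretary setting: $n$ elements with non-negative real weights $w_1\ge\dots\ge w_n$ fixed in advance. Element $i$ has arrival time $t_i$, with $t_1,\dots,t_n$ i.i.d. uniform on $[0,1]$; $w_i$ is revealed at time $t_i$ and must be immediately and irrevocably accepted or rejected. Up to $L$ elements may be accepted; $\mathrm{ALG}$ is the total weight of accepted elements, and the expectation is over the arrival times. The $L$-Selection Secretary algorithm with inputs $c$ and $\tau$: observe (and reject) all elements arriving up to time $\tau$; at time $\tau$ form the reference set $R$ consisting of the $L$ highest weights that arrived up to time $\tau$, and let $r_L$ be the $L$-th largest element of $R$ (if $R$ has fewer than $L$ elements, $r_L$ is a dummy element of weight $0$ regarded as having arrived before $\tau$). After time $\tau$, when an element $w_i$ arrives: if $w_i\ge\max(r_L,c)$ and $r_L$ arrived before time $\tau$, accept $w_i$, add it to $R$, remove $r_L$ from $R$, and update $r_L$ to be the $L$-th largest element of the new $R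$.
   Formalization: R is updated at every arrival after τ with w_i ≥ max(r_L,c); r_L having arrived before τ is required only to accept w_i. Updating R only on acceptance makes the bound false (L=2, weights 1,x,…,x, x→0). Ties between weights are broken by index, also in the test w_i ≥ r_L. *)

(* Defs.v *)
From mathcomp Require Import all_boot all_order all_algebra.
From mathcomp Require Import all_classical all_reals all_analysis.

Set Implicit Arguments.
Unset Strict Implicit.
Unset Printing Implicit Defensive.

Import Order.TTheory GRing.Theory Num.Theory.
Local Open Scope ring_scope.

(* Weights are indexed from 0: the k-th largest weight w_k of the usual
   notation is w`_(k.-1), and elements are the indices i : 'I_n. *)

Definition mutually_independent (d : measure_display) (T : measurableType d)
    (R : realType) (P : probability T R) (I : finType)
    (X : I -> {RV P >-> R}) : Prop :=
  forall (J : {set I}) (B : I -> set R), (forall i, measurable (B i)) ->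
    P (\bigcap_(i in [set` J]) (X i @^-1` B i))%classic =
    (\prod_(i in J) P (X i @^-1` B i)%classic)%E.

Definition iid_uniform01 (d : measure_display) (T : measurableType d)
    (R : realType) (P : probability T R) (n : nat)
    (t : 'I_n -> {RV P >-> R}) : Prop :=
  mutually_independent t /\
  forall i (B : set R), measurable B ->
    distribution P (t i) B = uniform_prob (@ltr01 R) B.

(* The algorithm compares elements by weight, breaking ties by index, so that
   the L-th largest element of a set is well defined; when the weights are
   pairwise distinct this is just w_i >= w_j.  The same order has to be used in
   the test w_i >= r_L: with L = 2, weights (1, x, ..., x), small x > 0 and many
   elements, letting every x replace an r_L equal to x soon puts an element that
   arrived after tau in position r_L, and weight 1 is then almost never taken. *)
Definition at_least (R : realType) (n : nat) (w : n.-tuple R) : rel 'I_n :=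
  fun i j => (w`_j < w`_i) || ((w`_i == w`_j) && (i <= j)%N).

Definition decreasing_list (R : realType) (n : nat) (w : n.-tuple R)
    (A : {set 'I_n}) : seq 'I_n :=
  sort (at_least w) (enum A).

Definition highest (R : realType) (n : nat) (w : n.-tuple R) (L : nat)
    (A : {set 'I_n}) : {set 'I_n} :=
  [set:: take L (decreasing_list w A)].

(* The L-th largest element r_L of A; None is the dummy element. *)
Definition Lth_largest (R : realType) (n : nat) (w : n.-tuple R) (L : nat)
    (A : {set 'I_n}) : option 'I_n :=
  onth (decreasing_list w A) L.-1.

(* The dummy has weight 0, loses ties, and arrived before tau. *)
Definition at_least_ref (R : realType) (n : nat) (w : n.-tuple R)
    (i : 'I_n) (r : option 'I_n) : bool :=
  if r is Some j then at_least w i j else 0 <= w`_i.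

Definition arrived_early (R : realType) (n : nat) (t : 'I_n -> R) (tau : R)
    (r : option 'I_n) : bool :=
  if r is Some j then t j <= tau else true.

Definition replace (n : nat) (r : option 'I_n) (i : 'I_n) (A : {set 'I_n}) :
    {set 'I_n} :=
  i |: (if r is Some j then A :\ j else A).

(* One arrival after tau; the state is (reference set, accepted elements).
   The reference set is updated for every arrival with w_i >= max(r_L, c), also
   when r_L arrived after tau and w_i is rejected.  Hence, among the elements
   that reach c, r_L is always the L-th largest seen so far, which gives it
   probability at least tau / s of having arrived before tau at time s.
   Updating only on acceptance would instead end all acceptances as soon as r_L
   is an accepted element; for L = 2 and weights (1, x, ..., x) with n large and
   x -> 0, the expected gain would then tend to (2 - 3/e)/e < 1/e. *)
Definition arrival (R : realType) (n : nat) (w : n.-tuple R) (L : nat)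
    (c tau : R) (t : 'I_n -> R) (s : {set 'I_n} * {set 'I_n}) (i : 'I_n) :
    {set 'I_n} * {set 'I_n} :=
  let: (ref, acc) := s in
  let r := Lth_largest w L ref in
  if at_least_ref w i r && (c <= w`_i) then
    (replace r i ref, if arrived_early t tau r then i |: acc else acc)
  else s.

Definition accepted (R : realType) (n : nat) (w : n.-tuple R) (L : nat)
    (c tau : R) (t : 'I_n -> R) : {set 'I_n} :=
  let observed := finset (fun i => t i <= tau) in
  let late := sort (fun i j => t i <= t j) (enum (~: observed)) in
  (foldl (arrival w L c tau t) (highest w L observed, finset.set0) late).2.

Definition ALG (R : realType) (n : nat) (w : n.-tuple R) (L : nat)
    (c tau : R) (t : 'I_n -> R) : R :=
  \sum_(i in accepted w L c tau t) w`_i.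

Definition OPT (R : realType) (n : nat) (w : n.-tuple R) (L : nat) : R :=
  \sum_(j < L) w`_j.

(* Main.v *)
Require Import Defs.
From mathcomp Require Import all_boot all_order all_algebra.
From mathcomp Require Import all_classical all_reals all_analysis.
From mathcomp Require Import measurable_realfun ring lra.

(* With the weights sorted, the order of the algorithm is the order of the
   indices, and the reference set consists of the L first elements of U, the set
   of the early elements and of the late ones seen so far with weight at least c.
   Index from 0 and write w_L for the (L+1)-st weight.

   If w_L < c, every element of the top L that arrives after tau is accepted:
   each is accepted with probability 1 - tau >= 3/5.  Otherwise
   w_L >= beta * OPT / 2.  Let i <= L arrive at time s > tau, and let A be the
   set of the elements that arrived before.  If fewer than L of them precede i,
   then i is accepted as soon as the L-th element of A (if any) is early, which
   has conditional probability at least tau / s.  For i < L the condition on A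
   is automatic; for i = L it fails with probability s^L.  The acceptance
   probabilities are therefore at least the integrals over [tau, 1] of tau / s
   and of tau / s * (1 - s^L).

   Instead of conditioning on the arrival time of i, ]tau, 1] is cut into N cells
   ]s, u], and only those outcomes are kept for which i is alone in its cell; for
   a given A they form a product event.  The resulting sums are Riemann sums up
   to an error O(1/N). *)

Import Order.TTheory GRing.Theory Num.Theory.
Local Open Scope ring_scope.

Set Implicit Arguments.
Unset Strict Implicit.
Unset Printing Implicit Defensive.

(** * Ranks and the reference set *)

Section Rank.
Variable n : nat.
Implicit Types (U V : {set 'I_n}) (i j k : 'I_n).

(** For sorted weights this counts the members of [U] that beat [k], from 0; [k] itself may lie
    outside [U], as a new arrival does. *)
Definition rank U k : nat := #|[set x in U | (x < k)%N]|.

Lemma enum_sorted U : sorted (fun i j => (i < j)%N) (enum U).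
Proof.
rewrite /enum_mem -enumT; apply: sorted_filter => [x y z|]; first exact: ltn_trans.
by have := iota_ltn_sorted 0 n; rewrite -val_enum_ord sorted_map.
Qed.

Lemma enum_set_sorted (s : seq 'I_n) :
  sorted (fun i j => (i < j)%N) s -> enum [set:: s] = s.
Proof.
move=> ss; apply: (@irr_sorted_eq _ (fun i j : 'I_n => (i < j)%N)) => //.
- by move=> x y z; exact: ltn_trans.
- by move=> x; rewrite /= ltnn.
- exact: enum_sorted.
- by move=> x; rewrite mem_enum inE.
Qed.

Lemma index_sorted (s : seq 'I_n) k : sorted (fun i j => (i < j)%N) s ->
  k \in s -> index k s = count (fun x : 'I_n => (x < k)%N) s.
Proof.
elim: s => //= a s IH pas; rewrite inE.
have ts : transitive (fun i j : 'I_n => (i < j)%N) by move=> x y z; exact: ltn_trans.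
have /allP as_ := order_path_min ts pas.
case: (eqVneq a k) => [ak|ak] /=.
  rewrite -ak ltnn add0n => _; apply/esym/eqP; rewrite -leqn0 leqNgt -has_count.
  by apply/hasPn => x /as_ /= ax; rewrite -leqNgt ltnW.
move=> ks; rewrite (as_ _ ks) (IH (path_sorted pas) ks).
by rewrite add1n.
Qed.

Lemma index_enum_rank U k : k \in U -> index k (enum U) = rank U k.
Proof.
move=> kU; rewrite index_sorted ?mem_enum//; last exact: enum_sorted.
rewrite /rank cardE /enum_mem -!enumT size_filter count_filter; apply: eq_count => x.
by rewrite /= inE andbC.
Qed.

Lemma onth_enumP U m j :
  onth (enum U) m = Some j -> j \in U /\ rank U j = m.
Proof.
move=> h; have jU : j \in U by rewrite -mem_enum; apply/onthP; exists m.
split=> //; rewrite -index_enum_rank//.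
have ms : (m < size (enum U))%N by rewrite -onthTE h.
by rewrite -{1}(@onth_nth _ j _ _ _ h) index_uniq// enum_uniq.
Qed.

Lemma onth_enumN U m : onth (enum U) m = None -> (#|U| <= m)%N.
Proof. by move=> h; rewrite cardE -onthNE h. Qed.

Lemma rank_le_card U i : (rank U i <= #|U|)%N.
Proof.
by apply: subset_leq_card; apply/fintype.subsetP => x; rewrite inE => /andP[].
Qed.

Lemma rank_lt_card U i : i \in U -> (rank U i < #|U|)%N.
Proof.
by move=> iU; rewrite -index_enum_rank// cardE index_mem mem_enum.
Qed.

Lemma rank_leq U i j : (i <= j)%N -> (rank U i <= rank U j)%N.
Proof.
move=> ij; apply: subset_leq_card; apply/fintype.subsetP => x.
by rewrite !inE => /andP[-> /= xi]; exact: leq_trans xi ij.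
Qed.

Lemma rank_ltn U i j : i \in U -> (i < j)%N -> (rank U i < rank U j)%N.
Proof.
move=> iU ij; apply: proper_card; apply/properP; split.
  by apply/fintype.subsetP => x; rewrite !inE => /andP[-> /= xi]; exact: ltn_trans xi ij.
by exists i; rewrite !inE ?iU// ltnn andbF.
Qed.

Lemma rank_inj U i j : i \in U -> j \in U -> rank U i = rank U j -> i = j.
Proof.
move=> iU jU e; apply/val_inj/eqP; rewrite eqn_leq.
by apply/andP; split; rewrite leqNgt; apply/negP;
  [move/(rank_ltn jU)|move/(rank_ltn iU)]; rewrite e ltnn.
Qed.

Lemma rank_le_ord U i : (rank U i <= i)%N.
Proof.
apply: (@leq_trans #|[set x : 'I_n | (x < i)%N]|).
  by apply: subset_leq_card; apply/fintype.subsetP => x; rewrite !inE => /andP[].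
have ni : (i <= n)%N by apply: ltnW.
rewrite -[leqRHS]card_ord; apply: leq_trans (leq_imset_card (widen_ord ni) 'I_i).
apply: subset_leq_card; apply/fintype.subsetP => x; rewrite !inE => xi.
by apply/imsetP; exists (Ordinal xi) => //; apply/val_inj.
Qed.

(** Only [i] indices lie below [i]; adding a missing [k] to [U] would push the rank beyond [i]. *)
Lemma rank_eq_ord U i : rank U i = i -> forall k, (k < i)%N -> k \in U.
Proof.
move=> ri k ki; apply/negPn/negP => kU.
suff : (rank U i < rank (k |: U) i)%N.
  by rewrite ri ltnNge rank_le_ord.
apply: proper_card; apply/properP; split.
  by apply/fintype.subsetP => x; rewrite !inE => /andP[-> ->]; rewrite orbT.
by exists k; rewrite !inE ?eqxx ?ki// (negbTE kU).
Qed.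

Lemma rank_setU1 U i k : i \notin U ->
  rank (i |: U) k = ((i < k) + rank U k)%N.
Proof.
move=> iU; rewrite /rank.
have -> : [set x in i |: U | (x < k)%N] =
    if (i < k)%N then i |: [set x in U | (x < k)%N] else [set x in U | (x < k)%N].
  apply/finset.setP => x; case: ltnP => ik; rewrite !inE.
    by have [->|] := eqVneq x i; rewrite /= ?ik.
  by have [->|] //= := eqVneq x i; rewrite ltnNge ik !andbF.
by case: ifPn => // _; rewrite cardsU1 inE (negbTE iU).
Qed.

End Rank.

(** * The run of the algorithm and deterministic conditions for acceptance *)

Section Run.
Variables (R : realType) (n : nat) (w : n.-tuple R).
Hypothesis w_decr : forall i j : 'I_n, (i <= j)%N -> w`_j <= w`_i.
Hypothesis w_ge0 : forall i : 'I_n, 0 <= w`_i.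
Variables (L : nat) (c tau : R) (t : 'I_n -> R).
Hypothesis L_gt0 : (0 < L)%N.
Implicit Types (U : {set 'I_n}) (i j k : 'I_n).

Lemma at_leastE i j : at_least w i j = (i <= j)%N.
Proof.
rewrite /at_least; case: leqP => [ij|ji].
  by have := w_decr ij; rewrite le_eqVlt eq_sym => /orP[]->; rewrite ?orbT.
by rewrite andbF orbF; apply/negbTE; rewrite -leNgt w_decr// ltnW.
Qed.

Lemma decreasing_listE U : decreasing_list w U = enum U.
Proof.
apply: sorted_sort.
  by move=> x y z; rewrite !at_leastE; exact: leq_trans.
by apply: sub_sorted (enum_sorted U) => x y; rewrite at_leastE => /ltnW.
Qed.

Lemma highestE U : highest w L U = [set k in U | (rank U k < L)%N].
Proof.
apply/finset.setP => k; rewrite /highest decreasing_listE !inE.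
have [kU|kU] := boolP (k \in U).
  by rewrite in_take ?mem_enum// index_enum_rank.
by apply/negbTE; apply: contra kU => /mem_take; rewrite mem_enum.
Qed.

(** Truncating to the first [L] elements keeps position [L.-1]; if [U] has fewer than [L] elements,
    both sides are the dummy. So the threshold can be read off from all of [U]. *)
Lemma Lth_largest_highest U :
  Lth_largest w L (highest w L U) = Lth_largest w L U.
Proof.
rewrite /Lth_largest !decreasing_listE /highest decreasing_listE.
rewrite enum_set_sorted; last first.
  by apply: take_sorted; exact: enum_sorted.
rewrite -{2}(cat_take_drop L (enum U)) onth_cat size_take.
case: (ltnP L) => [Ls|sL]; first by rewrite ltn_predL L_gt0.
case: ifPn => //; rewrite -leqNgt => h.
by rewrite take_oversize// drop_oversize// !onth_default.
Qed.

(** The invariant of the run. An arrival that reaches [c] either precedes the [L]-th element of [U]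
    and displaces it, or comes after it and falls outside the top [L] of [i |: U]. With the dummy as
    threshold, [U] has fewer than [L] elements and everything is kept. *)
Lemma arrival_ref U acc i : i \notin U ->
  (arrival w L c tau t (highest w L U, acc) i).1 =
  highest w L (if c <= w`_i then i |: U else U).
Proof.
move=> iU; rewrite /arrival Lth_largest_highest.
case: (lerP c w`_i) => _; rewrite ?andbF// andbT.
case E: (Lth_largest w L U) => [j|].
  move: E; rewrite /Lth_largest decreasing_listE => /onth_enumP[jU rj].
  have ne : i != j by apply: contraNneq iU => ->.
  rewrite /= at_leastE; case: leqP => [ij|ji] /=.
    have {ne}ij : (i < j)%N by rewrite ltn_neqAle ij andbT.
    rewrite !highestE; apply/finset.setP => k; rewrite !inE rank_setU1//.
    have [->|ki] := eqVneq k i.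
      rewrite ltnn add0n /=; apply/esym.
      by apply: leq_ltn_trans (rank_leq U (ltnW ij)) _; rewrite rj prednK.
    have [->|kj] /= := eqVneq k j; first by rewrite ij jU rj add1n prednK// ltnn.
    have [kU|//] /= := boolP (k \in U).
    have [kj'|jk] := ltnP k j.
      have := rank_ltn kU kj'; rewrite rj => h.
      apply/idP/idP => _; last by rewrite -(prednK L_gt0) ltnS ltnW.
      rewrite -(prednK L_gt0) ltnS; apply: leq_trans h.
      by case: (i < k)%N => //; exact: leqW.
    have {kj}jk : (j < k)%N by rewrite ltn_neqAle jk andbT eq_sym.
    have := rank_ltn jU jk; rewrite rj prednK// => h.
    rewrite ltnNge h /=; apply/esym/negbTE; rewrite -leqNgt.
    exact: leq_trans h (leq_addl _ _).
  rewrite !highestE; apply/finset.setP => k; rewrite !inE rank_setU1//.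
  have [->|ki] /= := eqVneq k i.
    rewrite (negbTE iU) ltnn add0n /=; apply/esym/negbTE; rewrite -leqNgt.
    by have := rank_ltn jU ji; rewrite rj prednK.
  have [kU|//] /= := boolP (k \in U).
  case: (ltnP i k) => [ik|]; last by rewrite add0n.
  have := rank_ltn jU (ltn_trans ji ik); rewrite rj prednK// => h.
  by rewrite !ltnNge h leqW.
move: E; rewrite /Lth_largest decreasing_listE => /onth_enumN h.
rewrite /= w_ge0 /= !highestE; apply/finset.setP => k; rewrite !inE rank_setU1//.
have [->|ki] /= := eqVneq k i.
  rewrite ltnn add0n; apply/esym.
  by apply: leq_ltn_trans (rank_le_card _ _) _; rewrite (leq_ltn_trans h)// prednK.
have [kU|//] /= := boolP (k \in U).
have := leq_trans (rank_lt_card kU) h => h'.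
apply/idP/idP => _; last by rewrite -(prednK L_gt0) ltnS ltnW.
rewrite -(prednK L_gt0) ltnS; apply: leq_trans h'.
by case: (i < k)%N => //; exact: leqW.
Qed.

Lemma foldl_arrival_ref (l : seq 'I_n) U acc :
  uniq l -> (forall x, x \in l -> x \notin U) ->
  (foldl (arrival w L c tau t) (highest w L U, acc) l).1 =
  highest w L (U :|: [set x in l | c <= w`_x]).
Proof.
elim: l U acc => [|x l IH] U acc.
  by move=> _ _ /=; congr highest; apply/finset.setP => y; rewrite !inE orbF.
rewrite [uniq _]/= => /andP[xl ul] lU; have xU := lU x (mem_head _ _).
rewrite -[foldl _ _ _]/(foldl _ (arrival w L c tau t (highest w L U, acc) x) l).
have := arrival_ref acc xU.
case: (arrival w L c tau t (highest w L U, acc) x) => ref acc' /= ->.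
rewrite IH//; last first.
  move=> y yl; have yU : y \notin U by apply: lU; rewrite inE yl orbT.
  by case: ifP => // _; rewrite !inE negb_or yU andbT; apply: contraNneq xl => <-.
congr highest; apply/finset.setP => y; case: ifP => cx; rewrite !inE.
  by have [->|] := eqVneq y x; rewrite ?cx ?orbT.
by have [->|] := eqVneq y x; rewrite //= cx andbF.
Qed.

(** Acceptance is irrevocable, so it suffices to follow the run up to the arrival of the element in
    question. *)
Lemma sub_foldl_arrival (l : seq 'I_n) (s : {set 'I_n} * {set 'I_n}) :
  s.2 \subset (foldl (arrival w L c tau t) s l).2.
Proof.
elim: l s => [|x l IH] s //; apply: fintype.subset_trans (IH (arrival w L c tau t s x)).
case: s => ref acc /=; case: ifP => _ //=; case: ifP => _ //.
exact: finset.subsetUr.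
Qed.

(** [B] stands for the late elements handled before [i]. Arrival times may coincide, so [B] is only
    known to lie between the strict and the non-strict predecessors of [i] in time. The top [L] of
    [U] is the reference set met by [i]. *)
Lemma accepted_threshold i : tau < t i -> c <= w`_i ->
  (forall B : {set 'I_n}, i \notin B ->
     (forall x, x \in B -> tau < t x /\ t x <= t i) ->
     (forall x, x != i -> tau < t x -> t x < t i -> x \in B) ->
     let U := [set x | (t x <= tau) || ((x \in B) && (c <= w`_x))] in
     forall j, j \in U -> rank U j = L.-1 -> (i <= j)%N /\ t j <= tau) ->
  i \in accepted w L c tau t.
Proof.
move=> ti cwi H; rewrite /accepted.
set obs := finset _; set late := sort _ _.
have late_sorted : sorted (fun i j => t i <= t j) late.
  by apply: sort_sorted => x y; exact: le_total.
have late_uniq : uniq late by rewrite sort_uniq enum_uniq.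
have late_mem x : (x \in late) = (tau < t x).
  by rewrite mem_sort mem_enum !inE ltNge.
have : i \in late by rewrite late_mem.
(* The list of late elements is cut at [i]; the part [s1] before it will serve as [B]. *)
clearbody late => il; case/splitPr: il late_sorted late_uniq late_mem => s1 s2.
have ttr : transitive (fun i j => t i <= t j) by move=> x y z; exact: le_trans.
rewrite -[s1 ++ _]/(s1 ++ ([:: i] ++ s2)) catA sorted_pairwise// => + ulate late_mem.
rewrite !pairwise_cat !allrel_catl.
move=> /and3P[/andP[_ h2] /and3P[h1 _ _] _].
have {}h1 x : x \in s1 -> t x <= t i.
  by move=> xs; apply: (allrelP h1) => //; rewrite inE.
have {}h2 x : x \in s2 -> t i <= t x.
  by move=> xs; apply: (allrelP h2) => //; rewrite inE.
move: ulate; rewrite cat_uniq => /and3P[]; rewrite cats1 rcons_uniq => /andP[is1 us1] _ _.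
rewrite foldl_cat -cats1 foldl_cat /=.
apply: (fintype.subsetP (sub_foldl_arrival _ _)).
have := @foldl_arrival_ref s1 obs finset.set0 us1.
case: (foldl _ _ s1) => ref acc /= ->; last first.
  move=> x xs; rewrite inE -ltNge -late_mem.
  by rewrite !mem_cat xs.
rewrite Lth_largest_highest.
set U := _ :|: _.
have {}H := H [set x in s1].
have UE : U = [set x | (t x <= tau) || ((x \in [set x in s1]) && (c <= w`_x))].
  by apply/finset.setP => x; rewrite !inE.
case E: (Lth_largest w L U) => [j|] /=; last first.
  by rewrite w_ge0 cwi /= !inE eqxx.
move: E; rewrite /Lth_largest decreasing_listE => /onth_enumP[jU rj].
have [] := H _ _ _ j; rewrite -?UE//.
- by rewrite inE.
- move=> x; rewrite inE => xs; split; last exact: h1.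
  by rewrite -late_mem !mem_cat xs.
- move=> x xi tx txi; have := late_mem x; rewrite tx !mem_cat !inE (negbTE xi) orbF.
  by case/orP => // /h2; rewrite leNgt txi.
- by move=> ij tj; rewrite at_leastE ij cwi tj !inE eqxx.
Qed.

(** Let [j] be the threshold. If it reaches [c], then [j < L] and its rank [L.-1] force [j = L.-1],
    so [U] contains all of the top [L], yet [i] is missing. Hence [w_j < c <= w_i]: [i] precedes
    [j], and [j] is early since late members of [U] reach [c]. *)
Lemma accepted_all_late i :
  (forall k : 'I_n, c <= w`_k -> (k < L)%N) ->
  c <= w`_i -> tau < t i -> i \in accepted w L c tau t.
Proof.
move=> cL cwi ti; apply: accepted_threshold => // B iB _ _ U j jU rj.
have iU : i \notin U by rewrite inE (negbTE iB) /= orbF -ltNge.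
have [cwj|cwj] := lerP c w`_j.
  have jr : rank U j = j.
    apply/eqP; rewrite eqn_leq rank_le_ord rj /=.
    by have := cL _ cwj; rewrite -{1}(prednK L_gt0).
  exfalso; have [ij|ji|/val_inj ij] := ltngtP i j.
  - by move: iU; rewrite (rank_eq_ord jr).
  - by have := cL _ cwi; rewrite -(prednK L_gt0) -rj jr ltnS leqNgt ji.
  - by move: iU; rewrite ij jU.
split; last first.
  by move: jU; rewrite inE [c <= _]leNgt cwj andbF orbF.
rewrite leqNgt; apply/negP => /ltnW/w_decr.
by rewrite leNgt (lt_le_trans cwj cwi).
Qed.

(** [U] and [A] have the same members among the elements that reach [c], and all predecessors of
    such an element reach [c] too, so its ranks in [U] and [A] agree. A threshold below [c] is early
    and comes after [i]. *)
Lemma accepted_pattern i (A : {set 'I_n}) (s : R) :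
  i \notin A -> (rank A i < L)%N -> c <= w`_i -> tau <= s -> s < t i ->
  (forall k, k \in A -> t k <= s) ->
  (forall k, k \notin A -> k != i -> t i < t k) ->
  (forall j, j \in A -> rank A j = L.-1 -> t j <= tau) ->
  i \in accepted w L c tau t.
Proof.
move=> iA ri cwi taus sti tA tNA early.
have ti : tau < t i by apply: le_lt_trans taus sti.
apply: accepted_threshold => // B iB B1 B2 U j jU rj.
have UA (x : 'I_n) : c <= w`_x -> (x \in U) = (x \in A).
  move=> cwx; apply/idP/idP; rewrite inE cwx andbT.
    move=> h; have [xi] : x != i /\ t x <= t i.
      case/orP: h => [xt|xB]; split.
      - by apply: contraTneq xt => ->; rewrite -ltNge.
      - by apply: le_trans xt (ltW ti).
      - by apply: contraNneq iB => <-.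
      - by case: (B1 _ xB).
    by apply: contraTT => /tNA /(_ xi); rewrite -ltNge.
  move=> xA; case: lerP => //= tx; apply: B2 => //.
    by apply: contraNneq iA => <-.
  by apply: le_lt_trans (tA _ xA) sti.
have [cwj|cwj] := lerP c w`_j.
  have jA : j \in A by rewrite -UA.
  have rA : rank A j = L.-1.
    rewrite -rj; apply: eq_card => x; rewrite !inE.
    case: ltnP => xj; rewrite ?andbF// !andbT -UA ?inE//.
    exact: le_trans cwj (w_decr (ltnW xj)).
  split; last exact: early.
  rewrite leqNgt; apply/negP => /(rank_ltn jA).
  by rewrite rA prednK// leqNgt ri.
split; last first.
  by move: jU; rewrite inE [c <= _]leNgt cwj andbF orbF.
rewrite leqNgt; apply/negP => /ltnW/w_decr.
by rewrite leNgt (lt_le_trans cwj cwi).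
Qed.

End Run.

(** * Product events and lower bounds on expectations *)

(** The flag [x] treats closed and open left ends together; both occur among the ranges below. *)
Lemma uniform_prob_itv (R : realType) (a b : R) (x : bool) :
  0 <= a -> a <= b -> b <= 1 ->
  uniform_prob (@ltr01 R) [set` Interval (BSide x a) (BRight b)]%classic =
  (b - a)%:E.
Proof.
move=> a0 ab b1; rewrite /uniform_prob.
have sub (z : R) : z \in Interval (BSide x a) (BRight b) -> 0 <= z <= 1.
  rewrite in_itv /= => /andP[az zb]; rewrite (le_trans zb b1) andbT.
  by case: x az => [|/ltW]; exact: le_trans.
rewrite (eq_integral (fun=> 1%:E)).
  rewrite integral_cst//= lebesgue_measure_itv/= mul1e lte_fin.
  case: ltP => [//|ba].
  by have -> : a = b; [apply/eqP; rewrite eq_le ab ba|rewrite subrr].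
by move=> z; rewrite inE /= => /sub; rewrite /uniform_pdf => ->; rewrite subr0 invr1.
Qed.

(* Y need not be measurable: ALG is never shown to be. *)
Lemma le_expectation (d : measure_display) (T : measurableType d)
    (R : realType) (P : probability T R) (X Y : T -> R) :
  (forall u, 0 <= X u) -> (forall u, X u <= Y u) ->
  ('E_P[X] <= 'E_P[Y])%E.
Proof.
move=> X0 XY; rewrite expectation.unlock.
rewrite !ge0_integralE.
- apply: le_ereal_sup => _ [h /= hX <-]; exists h => //= u; apply: le_trans (hX u) _.
  by rewrite !patch_setT lee_fin.
- by move=> u _; rewrite lee_fin (le_trans (X0 u)).
- by move=> u _; rewrite lee_fin.
Qed.

(** The weighted sum of indicators is a measurable minorant of [X], and linearity gives its
    expectation. *)
Lemma expectation_ge_events (d : measure_display) (T : measurableType d)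
    (R : realType) (P : probability T R) (J : finType) (a : J -> R)
    (E : J -> set T) (X : T -> R) :
  (forall j, 0 <= a j) -> (forall j, measurable (E j)) ->
  (forall u, \sum_j a j * \1_(E j) u <= X u) ->
  (\sum_j (a j)%:E * P (E j) <= 'E_P[X])%E.
Proof.
move=> a0 mE EX.
have -> : (\sum_j (a j)%:E * P (E j) = 'E_P[fun u => (\sum_j a j * \1_(E j) u)%R])%E.
  rewrite expectation.unlock; under eq_integral do rewrite -sumEFin.
  rewrite ge0_integral_sum//.
  - apply: eq_bigr => j _; under eq_integral do rewrite EFinM.
    rewrite ge0_integralZl//; first by rewrite integral_indic// setIT.
    + by apply/measurable_EFinP; exact: measurable_indic.
    + by rewrite lee_fin.
  - move=> j; apply/measurable_EFinP; apply: measurable_funM => //.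
  - by move=> j u _; rewrite lee_fin mulr_ge0.
by apply: le_expectation EX => u; apply: sumr_ge0 => j _; exact: mulr_ge0.
Qed.

Section Cylinder.
Context (d : measure_display) (T : measurableType d) (R : realType).
Variables (P : probability T R) (n : nat) (t : 'I_n -> {RV P >-> R}).
Hypothesis ht : iid_uniform01 t.

Lemma measurable_cylinder (B : 'I_n -> set R) : (forall k, measurable (B k)) ->
  measurable [set u | forall k, B k (t k u)]%classic.
Proof.
move=> mB; have -> : [set u | forall k, B k (t k u)]%classic =
    (\bigcap_(k in [set` [set: 'I_n]%SET]) (t k @^-1` B k))%classic.
  by apply/seteqP; split=> u /= h k; [move=> _; exact: h|exact: (h k (finset.in_setT k))].
apply: fin_bigcap_measurable => //= k _.
by rewrite -[X in measurable X]setTI; apply: measurable_funP.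
Qed.

Lemma probability_cylinder (B : 'I_n -> set R) (b : 'I_n -> R) :
  (forall k, measurable (B k)) ->
  (forall k, uniform_prob (@ltr01 R) (B k) = (b k)%:E) ->
  P [set u | forall k, B k (t k u)]%classic = (\prod_k b k)%:E.
Proof.
move=> mB bE; have -> : [set u | forall k, B k (t k u)]%classic =
    (\bigcap_(k in [set` [set: 'I_n]%SET]) (t k @^-1` B k))%classic.
  by apply/seteqP; split=> u /= h k; [move=> _; exact: h|exact: (h k (finset.in_setT k))].
case: ht => indep unif; rewrite indep// -prodEFin.
apply: eq_big => [k|k _]; first by rewrite finset.in_setT.
by rewrite -bE -(unif k _ (mB k)).
Qed.

End Cylinder.

(** * Probability of acceptance *)

Section Pattern.
Variables (R : realType) (n L : nat) (tau s u : R) (i : 'I_n).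
Hypotheses (tau_gt0 : 0 < tau) (tau_le : tau <= s) (su : s <= u) (u1 : u <= 1).
Implicit Types (A : {set 'I_n}) (k : 'I_n).

(* The range is empty when i is in A, so that no condition i \notin A is needed
   and sums over all A are products. *)
Definition pattern_range A k : set R :=
  if k == i then (if k \in A then set0 else `]s, u]%classic)
  else if k \in A then
    (if rank A k == L.-1 then `[0, tau]%classic else `[0, s]%classic)
  else `]u, 1]%classic.

Definition pattern_prob A k : R :=
  if k == i then (if k \in A then 0 else u - s)
  else if k \in A then (if rank A k == L.-1 then tau else s)
  else 1 - u.

(** This is [pattern_prob] with [tau] replaced by [s]: each factor depends on [A] only through
    whether [k] belongs to it, so the sum over all [A] factors. *)
Definition pattern_weight A k : R :=
  if k \in A then (if k == i then 0 else s)
  else (if k == i then u - s else 1 - u).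

Lemma measurable_pattern_range A k : measurable (pattern_range A k).
Proof. by rewrite /pattern_range; do !case: ifP => _. Qed.

Lemma uniform_pattern_range A k :
  uniform_prob (@ltr01 R) (pattern_range A k) = (pattern_prob A k)%:E.
Proof.
have s_ge0 : 0 <= s by apply: le_trans tau_le; exact: ltW.
rewrite /pattern_range /pattern_prob; case: ifP => _; case: ifP => _.
- by rewrite measure0.
- by rewrite uniform_prob_itv.
- case: ifP => _; rewrite uniform_prob_itv ?subr0//.
  + exact: ltW.
  + exact: le_trans tau_le (le_trans su u1).
  + exact: le_trans su u1.
- by rewrite uniform_prob_itv// (le_trans s_ge0).
Qed.

Lemma pattern_weight_ge0 A k : 0 <= pattern_weight A k.
Proof.
rewrite /pattern_weight; case: ifP => _; case: ifP => _ //; rewrite ?subr_ge0//.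
by apply: le_trans tau_le; exact: ltW.
Qed.

(* At most one element of A has rank L.-1, so at most one factor s is replaced
   by tau. *)
Lemma pattern_prob_ge A :
  tau / s * \prod_k pattern_weight A k <= \prod_k pattern_prob A k.
Proof.
have s_gt0 : 0 < s by apply: lt_le_trans tau_le.
have ts1 : tau / s <= 1 by rewrite ler_pdivrMr// mul1r.
have probE k : ~~ ((k \in A) && (rank A k == L.-1)) ->
    pattern_prob A k = pattern_weight A k.
  rewrite /pattern_prob /pattern_weight.
  by case: ifP => _; case: ifP => //= _ /negbTE ->.
have [[j /andP[jA /eqP jr]]|no] :=
    pselect (exists j, (j \in A) && (rank A j == L.-1)); last first.
  rewrite [leRHS](eq_bigr (pattern_weight A)) => [|k _]; last first.
    by apply: probE; apply/negP => h; apply: no; exists k.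
  by apply: ler_piMl => //; apply: prodr_ge0 => k _; exact: pattern_weight_ge0.
rewrite (bigD1 j)//= [leRHS](bigD1 j)//= mulrA.
rewrite [X in _ <= _ * X](eq_bigr (pattern_weight A)) => [|k kj]; last first.
  apply: probE; apply: contra kj => /andP[kA /eqP rk]; apply/eqP.
  by apply: (rank_inj kA jA); rewrite rk jr.
apply: ler_wpM2r; first by apply: prodr_ge0 => k _; exact: pattern_weight_ge0.
rewrite /pattern_prob /pattern_weight jA jr eqxx.
by case: ifP => _; rewrite ?mulr0// divfK// gt_eqF.
Qed.

Lemma sum_prod_set (F G : 'I_n -> R) :
  \sum_(A : {set 'I_n}) \prod_k (if k \in A then F k else G k) =
  \prod_k (F k + G k).
Proof. by rewrite bigA_distr. Qed.

Lemma bernoulli_le (x : R) m : 0 <= x -> x <= 1 -> 1 - m%:R * x <= (1 - x) ^+ m.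
Proof.
move=> x0 x1; elim: m => [|m IH]; first by rewrite mul0r subr0 expr0.
rewrite exprS; apply: (@le_trans _ _ ((1 - x) * (1 - m%:R * x))).
  have m0 : 0 <= m%:R :> R by [].
  by rewrite -natr1; nra.
by apply: ler_wpM2l => //; rewrite subr_ge0.
Qed.

(** Over all [A] the sum is $(u-s)(1-(u-s))^{n-1}$, the probability that [i] is alone in the cell,
    bounded by Bernoulli's inequality. The excluded [A] have rank at least [L] at [i]: there are
    none for [i < L], and for [i = L] they contain all predecessors of [i]. *)
Lemma sum_good_pattern_weight : (i <= L)%N ->
  (u - s) * (1 - n%:R * (u - s) - (if i == L :> nat then s ^+ L else 0)) <=
  \sum_(A : {set 'I_n} | (rank A i < L)%N) \prod_k pattern_weight A k.
Proof.
have s_ge0 : 0 <= s by apply: le_trans tau_le; exact: ltW.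
have d0 : 0 <= u - s by rewrite subr_ge0.
have d1 : u - s <= 1 by rewrite lerBlDr (le_trans u1)// lerDl.
pose F k := if k == i then 0 else s.
pose G k := if k == i then u - s else 1 - u.
have total : (u - s) * (1 - n%:R * (u - s)) <=
    \sum_(A : {set 'I_n}) \prod_k pattern_weight A k.
  rewrite (sum_prod_set F G) (bigD1 i)//= {1}/F {1}/G eqxx add0r.
  apply: ler_wpM2l => //; apply: le_trans (bernoulli_le n d0 d1) _.
  rewrite (eq_bigr (fun=> 1 - (u - s))) => [|k /negbTE ki]; last first.
    by rewrite /F /G ki; ring.
  rewrite prodr_const; apply: ler_wiXn2l.
  - by rewrite subr_ge0.
  - by rewrite gerBl.
  - by rewrite -[leqRHS]card_ord max_card.
move=> iL; rewrite (bigID (fun A : {set 'I_n} => (rank A i < L)%N)) /= in total.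
rewrite mulrBr lerBlDr; apply: le_trans total _; rewrite lerD2l.
case: eqP => [ieL|neL]; last first.
  rewrite mulr0 big1// => A; rewrite -leqNgt => LA; case: neL.
  by apply/eqP; rewrite eqn_leq iL (leq_trans LA (rank_le_ord _ _)).
(* Setting these factors to 0 removes every [A] that misses a predecessor of [i]. In the factored
   sum, each [k < i] then contributes [s] and each [k > i] contributes [s + (1 - u) <= 1]. *)
pose G' k := if (k < i)%N then 0 else G k.
apply: (@le_trans _ _ (\sum_(A : {set 'I_n})
    \prod_k (if k \in A then F k else G' k))).
  rewrite [leRHS](bigID (fun A : {set 'I_n} => (rank A i < L)%N)) /=.
  rewrite ler_wpDl//.
    apply: sumr_ge0 => A _; apply: prodr_ge0 => k _.
    rewrite /F /G' /G; do !case: ifP => _ //.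
    by rewrite subr_ge0.
  apply: ler_sum => A; rewrite -leqNgt => LA.
  have ri : rank A i = i.
    by apply/eqP; rewrite eqn_leq rank_le_ord ieL.
  rewrite le_eqVlt; apply/orP; left; apply/eqP; apply: eq_bigr => k _.
  rewrite /pattern_weight; case: ifPn => // kA.
  have /negbTE ki : ~~ (k < i)%N by apply: contra kA; exact: rank_eq_ord.
  by rewrite /G' ki.
rewrite sum_prod_set (bigD1 i)//= /F /G' /G eqxx ltnn add0r.
apply: ler_wpM2l => //.
apply: (@le_trans _ _ (\prod_(k < n | k != i) (if (k < i)%N then s else 1))).
  apply: ler_prod => k /negbTE ->; case: ifP => _; first by rewrite addr0 s_ge0 lexx.
  rewrite addr_ge0 ?subr_ge0//=; lra.
rewrite -big_mkcondr /= (eq_bigl (fun k : 'I_n => (k < i)%N)) => [|k]; last first.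
  by case: eqVneq => [->|]; rewrite ?ltnn.
have ni : (i <= n)%N by exact: ltnW.
by rewrite -(big_ord_widen n (fun=> s) ni) prodr_const card_ord ieL.
Qed.

End Pattern.

(** * Riemann sums on a uniform grid of [tau, 1] *)

Section Grid.
Variables (R : realType) (tau : R) (N : nat).
Hypotheses (tau_gt0 : 0 < tau) (tau_lt1 : tau < 1) (N_gt0 : (0 < N)%N).

Let step : R := (1 - tau) / N%:R.

Definition grid (m : nat) : R := tau + m%:R * step.

Let N_gt0' : 0 < N%:R :> R. Proof. by rewrite ltr0n. Qed.

Let step_gt0 : 0 < step.
Proof. by rewrite divr_gt0// subr_gt0. Qed.

Lemma gridS m : grid m.+1 = grid m + step.
Proof. by rewrite /grid -natr1 mulrDl mul1r addrA. Qed.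

Lemma grid_step m : grid m.+1 - grid m = step.
Proof. by rewrite gridS addrAC subrr add0r. Qed.

Lemma le_grid m p : (m <= p)%N -> grid m <= grid p.
Proof. by move=> mp; rewrite lerD2l ler_wpM2r// ?ler_nat// ltW. Qed.

Lemma grid0 : grid 0 = tau. Proof. by rewrite /grid mul0r addr0. Qed.

Lemma gridN : grid N = 1.
Proof. by rewrite /grid mulrC divfK ?gt_eqF// addrC subrK. Qed.

Lemma tau_le_grid m : tau <= grid m.
Proof. by rewrite -{1}grid0 le_grid. Qed.

Lemma grid_gt0 m : 0 < grid m.
Proof. exact: lt_le_trans (tau_le_grid m). Qed.

(** Left endpoints overestimate the integral of the decreasing function $1/s$. Cell by cell this is
    $\ln(1+x)\le x$ with $x$ = [step / grid p], and the logarithms telescope. *)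
Lemma sum_grid_inv : - ln tau <= \sum_(m < N) step / grid m.
Proof.
suff h p : ln (grid p) - ln tau <= \sum_(m < p) step / grid m.
  by have := h N; rewrite gridN ln1 sub0r.
elim: p => [|p IH]; first by rewrite grid0 subrr big_ord0.
rewrite big_ord_recr /=; apply: le_trans (lerD IH (lexx _)).
rewrite addrAC lerD2r -lerBlDl -ln_div ?posrE ?grid_gt0//.
rewrite gridS mulrDl divff ?gt_eqF ?grid_gt0//.
have h : 0 < step / grid p by rewrite divr_gt0// grid_gt0.
by apply: le_ln1Dx; apply: lt_trans h; rewrite oppr_lt0.
Qed.

(** Left endpoints underestimate the integral of $s^{L-1}$. Cell by cell this is the tangent
    inequality for $x^L$, and the powers telescope. *)
Lemma sum_grid_exp L : (0 < L)%N ->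
  \sum_(m < N) step * grid m ^+ L.-1 <= (1 - tau ^+ L) / L%:R.
Proof.
move=> L0; rewrite ler_pdivlMr ?ltr0n//.
have tangent (x : R) l : 0 <= x ->
    x ^+ l.+1 + l.+1%:R * step * x ^+ l <= (x + step) ^+ l.+1.
  move=> x0; elim: l => [|l IH]; first by rewrite !expr1 expr0 mulr1 mul1r.
  rewrite exprS; apply: le_trans (ler_wpM2l _ IH); last exact: addr_ge0 (ltW _).
  have xl : 0 <= x ^+ l by exact: exprn_ge0.
  rewrite !exprS -[l.+2%:R]natr1; set y := x ^+ l in xl *.
  have l0 : 0 <= l.+1%:R :> R by [].
  rewrite -subr_ge0.
  rewrite [X in 0 <= X](_ : _ = l.+1%:R * step ^+ 2 * y); last by ring.
  by rewrite mulr_ge0// mulr_ge0// sqr_ge0.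
suff h p : (\sum_(m < p) step * grid m ^+ L.-1) * L%:R <= grid p ^+ L - tau ^+ L.
  by have := h N; rewrite gridN expr1n.
elim: p => [|p IH]; first by rewrite big_ord0 mul0r grid0 subrr.
rewrite big_ord_recr /= mulrDl; apply: le_trans (lerD IH (lexx _)) _.
have := tangent (grid p) L.-1 (ltW (grid_gt0 p)); rewrite prednK// -gridS.
set a := grid p ^+ L; set b := grid p ^+ L.-1; set c := grid p.+1 ^+ L; lra.
Qed.

End Grid.

(* A is the set of the elements that arrive before i. *)
Definition early_threshold (R : realType) (n L : nat) (tau : R)
    (t : 'I_n -> R) (i : 'I_n) : Prop :=
  exists (A : {set 'I_n}) (s : R),
    [/\ i \notin A /\ (rank A i < L)%N, tau <= s /\ s < t i,
        forall k, k \in A -> t k <= s,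
        forall k, k \notin A -> k != i -> t i < t k &
        forall j, j \in A -> rank A j = L.-1 -> t j <= tau].

(** * Summing the product events over cells and sets *)

Section Cells.
Context (d : measure_display) (T : measurableType d) (R : realType).
Variables (P : probability T R) (n : nat) (t : 'I_n -> {RV P >-> R}).
Hypothesis ht : iid_uniform01 t.
Variables (L : nat) (tau : R) (i : 'I_n).
Hypotheses (L_gt0 : (0 < L)%N) (tau_gt0 : 0 < tau) (tau_lt1 : tau < 1).
Hypothesis iL : (i <= L)%N.

Definition pattern_event (s u : R) (A : {set 'I_n}) : set T :=
  [set x | forall k, pattern_range L tau s u i A k (t k x)]%classic.

Lemma pattern_eventE s u A x : tau <= s -> pattern_event s u A x ->
  [/\ i \notin A, s < t i x <= u,
      forall k, k \in A -> t k x <= s,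
      forall k, k \notin A -> k != i -> u < t k x &
      forall j, j \in A -> rank A j = L.-1 -> t j x <= tau].
Proof.
move=> ts E; have := E i; rewrite /pattern_range eqxx.
case: ifP => [//|/negbT iA]; rewrite /= in_itv /= => ti; split=> //.
- move=> k kA; have := E k; rewrite /pattern_range kA.
  case: eqVneq => [ki|_]; first by move: iA; rewrite -ki kA.
  case: ifP => _; rewrite /= in_itv /= => /andP[_]//.
  by move/le_trans; exact.
- move=> k kA /negbTE ki; have := E k; rewrite /pattern_range ki (negbTE kA).
  by rewrite /= in_itv /= => /andP[].
- move=> j jA rj; have := E j; rewrite /pattern_range jA rj eqxx.
  case: eqVneq => [ji|_]; first by move: iA; rewrite -ji jA.
  by rewrite /= in_itv /= => /andP[].
Qed.

(** [G] is the union of the pattern events over all cells and all [A] with [rank A i < L]. They are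
    disjoint, so their probabilities add up. *)
Lemma probability_cells (N : nat) : (0 < N)%N ->
  exists G : set T, [/\ measurable G,
    forall x, G x -> early_threshold L tau (fun k => t k x) i &
    ((\sum_(m < N) tau / grid tau N m * ((1 - tau) / N%:R *
      (1 - n%:R * ((1 - tau) / N%:R)
         - (if i == L :> nat then grid tau N m ^+ L else 0))))%:E <= P G)%E].
Proof.
move=> N0; set g := grid tau N.
pose E (p : 'I_N * {set 'I_n}) := pattern_event (g p.1) (g p.1.+1) p.2.
pose good := [set p : 'I_N * {set 'I_n} | (rank p.2 i < L)%N].
have mE p : measurable (E p).
  by apply: measurable_cylinder => k; exact: measurable_pattern_range.
have tg m : tau <= g m by exact: tau_le_grid.
have gm (m p : nat) : (m <= p)%N -> g m <= g p by exact: le_grid.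
(* The cell is the one that contains [t i x]; then [A] consists of the elements that arrive before
   this cell, all others except [i] arriving after it. *)
have disj p q x : E p x -> E q x -> p = q.
  case: p q => [m A] [m' A'] /(pattern_eventE (tg _)) /= [iA /andP[ms mu] h1 h2 _].
  move=> /(pattern_eventE (tg _)) /= [iA' /andP[ms' mu'] h1' h2' _].
  have mm' : m = m'.
    apply/val_inj => /=; have [mm|mm|//] := ltngtP m m'.
      by have := lt_le_trans ms' (le_trans mu (gm _ _ mm)); rewrite ltxx.
    by have := lt_le_trans ms (le_trans mu' (gm _ _ mm)); rewrite ltxx.
  subst m'; congr pair; apply/finset.setP => k.
  have [->|ki] := eqVneq k i; first by rewrite (negbTE iA) (negbTE iA').
  apply/idP/idP => kA; apply/negPn/negP => kA'.
    by have := lt_le_trans (h2' _ kA' ki) (le_trans (h1 _ kA) (gm _ _ (leqnSn m)));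
       rewrite ltxx.
  by have := lt_le_trans (h2 _ kA' ki) (le_trans (h1' _ kA) (gm _ _ (leqnSn m)));
     rewrite ltxx.
exists (\bigcup_(p in [set` enum good]) E p)%classic; split.
- by apply: fin_bigcup_measurable.
- move=> x [p /=]; rewrite mem_enum inE => pg /(pattern_eventE (tg _)).
  move=> [iA /andP[ms mu] h1 h2 h3].
  exists p.2, (g p.1); split=> //.
  by move=> k kA ki; apply: le_lt_trans mu (h2 _ kA ki).
rewrite measure_fin_bigcup//; last first.
  apply/trivIsetP => p q _ _ /eqP pq; apply/seteqP; split=> // x [Ep Eq].
  by case: pq; exact: disj Ep Eq.
rewrite -fsbig_seq ?enum_uniq//= big_enum /=.
have PE p : P (E p) = (\prod_k pattern_prob L tau (g p.1) (g p.1.+1) i p.2 k)%:E.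
  apply: (probability_cylinder ht) => k; first exact: measurable_pattern_range.
  apply: uniform_pattern_range => //; first exact: gm.
  by rewrite -(gridN tau N0) gm.
rewrite (eq_bigr (fun p : 'I_N * {set 'I_n} =>
  (\prod_k pattern_prob L tau (g p.1) (g p.1.+1) i p.2 k)%:E)) => [|p _]; last exact: PE.
rewrite sumEFin lee_fin (eq_bigl (fun p => (rank p.2 i < L)%N)); last first.
  by move=> p; rewrite inE.
rewrite -(pair_big_dep xpredT (fun _ (A : {set 'I_n}) => (rank A i < L)%N)
  (fun m A => \prod_k pattern_prob L tau (g (m : 'I_N)) (g m.+1) i A k)) /=.
apply: ler_sum => m _.
have g1 : g m.+1 <= 1 by rewrite -(gridN tau N0) gm.
have gmm : g m <= g m.+1 by rewrite gm.
have := sum_good_pattern_weight tau_gt0 (tg m) gmm g1 iL.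
rewrite [g _ - g _]grid_step => h.
apply: (@le_trans _ _ (\sum_(A : {set 'I_n} | (rank A i < L)%N)
   tau / g m * \prod_k pattern_weight (g m) (g m.+1) i A k)); last first.
  by apply: ler_sum => A _; exact: pattern_prob_ge.
rewrite -mulr_sumr ler_wpM2l// divr_ge0 ?ltW//.
exact: lt_le_trans (tg m).
Qed.

Lemma probability_early_threshold (eps : R) : 0 < eps -> ln tau = -1 ->
  exists G : set T, [/\ measurable G,
    forall x, G x -> early_threshold L tau (fun k => t k x) i &
    ((tau - (if i == L :> nat then tau * (1 - tau ^+ L) / L%:R else 0) - eps)%:E
      <= P G)%E].
Proof.
move=> eps0 ln_tau.
(* Fine enough cells make the loss from requiring [i] to be alone in its cell at most [eps]. *)
have [N N0 Neps] : exists2 N, (0 < N)%N & n%:R * ((1 - tau) / N%:R) <= eps.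
  exists (Num.trunc (n%:R / eps)).+1 => //.
  rewrite mulrA ler_pdivrMr ?ltr0n// -ler_pdivrMl// mulrC.
  apply: le_trans (ltW (truncnS_gt _)).
  rewrite ler_wpM2r ?invr_ge0 ?(ltW eps0)//.
  by rewrite ler_piMr// gerBl (ltW tau_gt0).
have [G [mG GE GP]] := probability_cells N0; exists G; split => //.
apply: le_trans GP; rewrite lee_fin.
set dl := (1 - tau) / N%:R in Neps *; set g := grid tau N.
have dl0 : 0 <= dl by rewrite divr_ge0// subr_ge0 ltW.
have g0 m : 0 < g m by exact: grid_gt0.
have tg m : tau <= g m by exact: tau_le_grid.
pose S0 := \sum_(m < N) dl / g m.
pose S1 := \sum_(m < N) dl * g m ^+ L.-1.
have S0_ge : 1 <= S0.
  by have := sum_grid_inv tau_gt0 tau_lt1 N0; rewrite ln_tau opprK.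
have S1_le : S1 <= (1 - tau ^+ L) / L%:R by exact: sum_grid_exp.
(* Each [tau / g m] is at most 1 and the steps sum to [1 - tau]. This bound keeps the error term,
   which is multiplied by [tau * S0], below [eps]. *)
have tauS0 : tau * S0 <= 1.
  rewrite /S0 mulr_sumr (@le_trans _ _ (\sum_(m < N) dl))//.
    apply: ler_sum => m _; rewrite mulrCA ler_piMr//.
    by rewrite ler_pdivrMr// mul1r.
  rewrite sumr_const card_ord -mulr_natl /dl mulrC divfK ?gt_eqF ?ltr0n//.
  by rewrite gerBl ltW.
have -> : \sum_(m < N) tau / g m * (dl * (1 - n%:R * dl -
    (if i == L :> nat then g m ^+ L else 0))) =
    tau * S0 - n%:R * dl * (tau * S0) - (if i == L :> nat then tau * S1 else 0).
  have -> : (if i == L :> nat then tau * S1 else 0) = \sum_(m < N)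
      (if i == L :> nat then tau * (dl * g m ^+ L.-1) else 0).
    by case: ifP => _; rewrite ?mulr_sumr// big1.
  rewrite /S0 !mulr_sumr -!sumrB; apply: eq_bigr => m _.
  have gm0 : g m != 0 by rewrite gt_eqF.
  case: ifP => _; last by field.
  have -> : g m ^+ L = g m * g m ^+ L.-1 by rewrite -exprS prednK.
  by field.
have h1 : n%:R * dl * (tau * S0) <= eps.
  apply: le_trans Neps; rewrite ler_piMr// mulr_ge0//.
have h2 : tau <= tau * S0 by rewrite ler_peMr// ltW.
case: ifP => _; last by lra.
have h3 : tau * S1 <= tau * (1 - tau ^+ L) / L%:R.
  by rewrite -mulrA ler_wpM2l// ltW.
lra.
Qed.

End Cells.

(** * Lower bound on the expected gain *)

Section Expectation.
Context (d : measure_display) (T : measurableType d) (R : realType).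
Variables (P : probability T R) (n : nat) (t : 'I_n -> {RV P >-> R}).
Variables (w : n.-tuple R) (L : nat) (c tau : R).
Hypothesis w_ge0 : forall i : 'I_n, 0 <= w`_i.

(** Linearity of expectation, with each acceptance event replaced by a measurable event inside
    it. *)
Lemma expectation_ALG_ge (K : pred 'I_n) (p : 'I_n -> R) :
  (forall i, K i -> exists G : set T, [/\ measurable G,
     forall x, G x -> i \in accepted w L c tau (fun k => t k x) &
     ((p i)%:E <= P G)%E]) ->
  ((\sum_(i | K i) w`_i * p i)%:E <=
    'E_P[fun x => ALG w L c tau (fun k => t k x)])%E.
Proof.
move=> H.
have /boolp.choice[G HG] : forall i, exists Gi : set T, measurable Gi /\
    (K i -> (forall x, Gi x -> i \in accepted w L c tau (fun k => t k x)) /\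
            ((p i)%:E <= P Gi)%E).
  move=> i; case: (boolP (K i)) => [/H[Gi [? ? ?]]|_]; first by exists Gi.
  (* Outside [K] the empty event is a default value; its coefficient is 0. *)
  by exists set0; split.
apply: (@le_trans _ _
    (\sum_i (if K i then w`_i else 0)%:E * P (G i))%E).
  rewrite -sumEFin big_mkcond /=; apply: lee_sum => i _.
  case: ifPn => [Ki|_]; last by rewrite mul0e.
  have [_ /(_ Ki)[_ pG]] := HG i.
  by rewrite EFinM; apply: lee_wpmul2l => //; rewrite lee_fin.
apply: expectation_ge_events => [i|i|x]; first by case: ifP.
  by have [] := HG i.
rewrite /ALG [leRHS]big_mkcond /=; apply: ler_sum => i _.
case: ifPn => [Ki|_]; last by rewrite mul0r; case: ifP.
rewrite indicE; case: (boolP (x \in G i)) => [|_]; last by rewrite mulr0; case: ifP.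
by rewrite inE => xG; have [_ /(_ Ki)[/(_ _ xG) -> _]] := HG i; rewrite mulr1.
Qed.

Lemma OPT_widen : (L <= n)%N -> OPT w L = \sum_(i < n | (i < L)%N) w`_i.
Proof. by move=> Ln; rewrite /OPT (big_ord_widen n (fun i => w`_i) Ln). Qed.

End Expectation.

(** $e=(e^{1/8})^8\ge(9/8)^8>5/2$. This gives $1/e\le 2/5$, sharp enough for the case $w_L<c$ of the
    theorem. *)
Lemma expR1_ge (R : realType) : 5 / 2 <= expR 1 :> R.
Proof.
have -> : expR 1 = expR (1 / 8) ^+ 8 :> R.
  by rewrite -expRM_natl; congr expR; field.
have h : 9 / 8 <= expR (1 / 8) :> R.
  by apply: le_trans (expR_ge1Dx _); lra.
have : (9 / 8) ^+ 8 <= expR (1 / 8) ^+ 8 :> R.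
  by apply: lerXn2r => //; rewrite nnegrE; lra.
by apply: le_trans; lra.
Qed.

Theorem mainTheorem7 (R : realType) (d : measure_display)
    (T : measurableType d) (P : probability T R)
    (L n : nat) (hL : (1 <= L)%N) (hn : (L.+1 <= n)%N)
    (w : n.-tuple R)
    (w_decr : forall i j : 'I_n, (i <= j)%N -> w`_j <= w`_i)
    (w_ge0 : forall i : 'I_n, 0 <= w`_i)
    (beta : R) (beta_ge0 : 0 <= beta) (beta_le1 : beta <= 1)
    (hbeta : w`_L.-1 = beta * OPT w L)
    (t : 'I_n -> {RV P >-> R}) (ht : iid_uniform01 t) :
  let e := expR 1 : R in
  let c := w`_L.-1 - w`_L in
  let tau := 1 / e in
  (((1 / e + beta / (2 * e) * (1 - 1 / L%:R + 1 / (L%:R * e ^+ L)))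
      * OPT w L)%:E
   <= 'E_P[fun omega => ALG w L c tau (fun i => t i omega)])%E.
Proof.
cbv zeta; set e : R := expR 1; set c := _ - w`_L; set tau := 1 / e.
have e_ge : 5 / 2 <= e by exact: expR1_ge.
have e_gt0 : 0 < e by lra.
have tau_gt0 : 0 < tau by rewrite divr_gt0.
have tau_le : tau <= 2 / 5 by rewrite /tau ler_pdivrMr//; lra.
have tau_lt1 : tau < 1 by lra.
have ln_tau : ln tau = -1 by rewrite /tau mul1r lnV ?posrE// expRK.
have L_gt0 : 0 < L%:R :> R by rewrite ltr0n.
have OPTE : OPT w L = \sum_(i < n | (i < L)%N) w`_i by rewrite OPT_widen// ltnW.
have OPT_ge0 : 0 <= OPT w L by rewrite OPTE; exact: sumr_ge0.
have Ln : (L.-1 < n)%N by apply: leq_ltn_trans (leq_pred _) hn.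
have w_decr_L (k : 'I_n) : (L <= k)%N -> w`_k <= w`_L.
  by move=> Lk; apply: (w_decr (Ordinal hn)).
have c_le (k : 'I_n) : (k < L)%N -> c <= w`_k.
  move=> kL; apply: (@le_trans _ _ w`_L.-1).
    by rewrite gerBl; exact: (w_ge0 (Ordinal hn)).
  by apply: (w_decr k (Ordinal Ln)); rewrite /= -ltnS prednK.
(* Since $\tau^L=1/e^L$, this is the bracket of the statement; [tau * q] will be the acceptance
   bound for the element of index [L]. *)
set q := 1 - (1 - tau ^+ L) / L%:R.
have tauL_ge0 : 0 <= tau ^+ L by rewrite exprn_ge0 // ltW.
have tauL_le1 : tau ^+ L <= 1 by rewrite exprn_ile1// ltW.
have q_le1 : q <= 1 by rewrite gerBl divr_ge0 ?subr_ge0.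
have q_ge0 : 0 <= q.
  rewrite subr_ge0 ler_pdivrMr// mul1r (@le_trans _ _ 1) ?gerBl//.
  by rewrite ler1n.
have -> : (tau + beta / (2 * e) * (1 - 1 / L%:R + 1 / (L%:R * e ^+ L))) =
    tau * (1 + beta / 2 * q).
  rewrite /q /tau expr_div_n expr1n; field.
  by rewrite !gt_eqF// exprn_gt0.
have [cL|cL] := lerP c w`_L; last first.
  have := @expectation_ALG_ge _ _ _ P n t w L c tau w_ge0
    (fun i => (i < L)%N) (fun=> 1 - tau).
  rewrite -mulr_suml -OPTE => H; apply: le_trans (H _); last first.
    move=> i iL; exists (t i @^-1` `]tau, 1])%classic; split.
    - by rewrite -[X in measurable X]setTI; apply: measurable_funP.
    - move=> x /=; rewrite in_itv /= => /andP[ti _].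
      apply: accepted_all_late => //; last exact: c_le.
      move=> k ck; rewrite ltnNge; apply/negP => /w_decr_L.
      by rewrite leNgt (lt_le_trans cL ck).
    - case: ht => _ /(_ i `]tau, 1]%classic (measurable_itv _)).
      by rewrite (uniform_prob_itv _ (ltW tau_gt0) (ltW tau_lt1) (lexx 1)) => <-.
  rewrite lee_fin mulrC ler_wpM2l//.
  (* The target coefficient is thus at most $\frac32\tau\le\frac35\le 1-\tau$. *)
  have : beta * q <= 1 by rewrite mulr_ile1.
  nra.
have wL_ge0 : 0 <= w`_L := w_ge0 (Ordinal hn).
(* Here $c\le w_L$ says $w_{L-1}\le 2w_L$, and $w_{L-1}=\beta\,\mathrm{OPT}$. *)
have wL_ge : beta * OPT w L <= 2 * w`_L by rewrite -hbeta; rewrite /c in cL; lra.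
apply/lee_subgt0Pr => eps eps_gt0.
have M_gt0 : 0 < OPT w L + w`_L + 1 by lra.
(* Losing [eps'] in each acceptance probability costs [eps' * (OPT w L + w_L)] in total; the added 1
   keeps the denominator positive. *)
pose eps' := eps / (OPT w L + w`_L + 1).
have eps'_gt0 : 0 < eps' by rewrite divr_gt0.
have eps'E : eps' * (OPT w L + w`_L) <= eps.
  rewrite /eps' mulrAC ler_pdivrMr//; nra.
pose p (i : 'I_n) := tau -
  (if i == L :> nat then tau * (1 - tau ^+ L) / L%:R else 0) - eps'.
have := @expectation_ALG_ge _ _ _ P n t w L c tau w_ge0 (fun i => (i <= L)%N) p.
move=> H; apply: le_trans (H _); last first.
  move=> i iL; have [G [mG GE GP]] :=
    probability_early_threshold ht hL tau_gt0 tau_lt1 iL eps'_gt0 ln_tau.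
  exists G; split=> // x /GE[A [s [[iA ri] [ts si] h1 h2 h3]]].
  apply: (accepted_pattern w_decr w_ge0 hL iA ri _ ts si h1 h2 h3).
  by apply: le_trans cL _; exact: (w_decr i (Ordinal hn)).
(* The element of index [L] is split off. The others give about [tau * OPT], and it adds about
   [tau * q * w_L], at least half of [tau * q * beta * OPT]. *)
rewrite (bigD1 (Ordinal hn))//=
  (eq_bigr (fun i : 'I_n => w`_i * (tau - eps'))); last first.
  move=> i /andP[_ iL]; rewrite /p ifN ?subr0//.
rewrite -mulr_suml (eq_bigl (fun i : 'I_n => (i < L)%N)); last first.
  by move=> i; rewrite [RHS]ltn_neqAle andbC.
rewrite -OPTE /p /= eqxx -EFinB lee_fin.
have -> : tau - tau * (1 - tau ^+ L) / L%:R - eps' = tau * q - eps'.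
  by rewrite /q; ring.
have h : tau * q * (beta * OPT w L) <= tau * q * (2 * w`_L).
  by apply: ler_wpM2l => //; rewrite mulr_ge0// ltW.
move: h eps'E; set O := OPT w L; set a := w`_L; lra.
Qed.
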